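(* Let $n,x,t\in\mathbb{N}$ be positive integers such that $n$ is even and $n\geq 2x+4t$, and let $G=\mathrm{Circ}(n,\{x,x+1,\ldots,x+2t-1\})$. Then $G$ is a nut graph if and only if $\gcd(\frac n2,t)=1$ and $\gcd(\frac n2,2x+2t-1)=1$.
   Context: For $n\in\mathbb{N}$ and a generator set $S\subseteq\{1,\dots,\lfloor n/2\rfloor\}$, $\mathrm{Circ}(n,S)$ denotes the circulant graph with vertex set $V=\{0,1,\dots,n-1\}$ in which $i$ is adjacent to $i\pm s$ (computed modulo $n$) for every $i\in V$ and $s\in S$. A simple graph with at least two vertices is a nut graph if its adjacency matrix has the eigenvalue $0$ with multiplicity exactly $1$ and an eigenvector corresponding to $0$ has no zero entries. *)

(* Defs.v *)
From mathcomp Require Import all_boot all_order all_algebra.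
From mathcomp Require Import reals.

Set Implicit Arguments.
Unset Strict Implicit.
Unset Printing Implicit Defensive.

Import GRing.Theory Num.Theory.

Local Open Scope ring_scope.

Definition simple_graph n (e : rel 'I_n) : Prop := symmetric e /\ irreflexive e.

Definition adjmx (R : realType) n (e : rel 'I_n) : 'M[R]_n :=
  \matrix_(i, j) (e i j)%:R.

(* [mup 0 (char_poly A)] is the multiplicity of 0 as an eigenvalue of A.
   MathComp's eigenspaces consist of row vectors; this is immaterial here since
   the adjacency matrix of a simple graph is symmetric. *)
Definition nut_graph (R : realType) n (e : rel 'I_n) : Prop :=
  let A := adjmx R e in
  [/\ simple_graph e,
      (2 <= n)%N,
      mup 0 (char_poly A) = 1%N
    & exists v : 'rV[R]_n,
        [/\ v != 0, (v <= eigenspace A 0)%MS & forall j, v 0 j != 0]].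

(* Circ(n, S), where S is meant to be a subset of {1, ..., n./2}.  The second
   disjunct says j = i - s modulo n, avoiding truncated subtraction. *)
Definition circ n (S : seq nat) : rel 'I_n :=
  fun i j => has (fun s => (j == i + s %[mod n]) || (j + s == i %[mod n])) S.
Arguments circ : clear implicits.

(* Main.v *)
Require Import Defs.
From mathcomp Require Import all_boot all_order all_algebra all_field.
From mathcomp Require Import reals zify.

(** A circulant matrix is diagonalised by the Vandermonde matrix of the [n]-th
    roots of unity, so the multiplicity of the eigenvalue 0 is the number of
    roots [w] at which [P w = \sum_s (w ^ s + w ^ (n - s))] vanishes.  Summing
    the geometric progressions,
    [(w - 1) w ^ (x + 2t - 1) P w = (w ^ 2t - 1) (w ^ (2x + 2t - 1) + 1)],
    so [P (-1) = 0], and the entries of the corresponding eigenvector are all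
    [1] or [-1].  The graph is thus a nut graph iff [-1] is the only root of
    unity other than [1] satisfying [w ^ 2t = 1] or [w ^ (2x + 2t - 1) = -1],
    which is what the two gcd conditions say. *)

Set Implicit Arguments.
Unset Strict Implicit.
Unset Printing Implicit Defensive.

Import GRing.Theory Num.Theory.
Local Open Scope ring_scope.

(** * Multiplicities, conjugation and Vandermonde determinants *)

Lemma mup_map (F K : fieldType) (f : {rmorphism F -> K}) (x : F) (p : {poly F}) :
  p != 0 -> mup (f x) (map_poly f p) = mup x p.
Proof.
(* A multiplicity is determined by which powers of ['X - x] divide [p], and a field morphism
   preserves and reflects divisibility. *)
move=> p_neq0; have mup_geE k : (k <= mup (f x) (map_poly f p))%N = (k <= mup x p)%N.
  rewrite !mup_geq ?map_poly_eq0 //.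
  by rewrite -(map_polyX f) -map_polyC -rmorphB -rmorphXn dvdp_map.
by apply/eqP; rewrite eqn_leq -mup_geE leqnn mup_geE leqnn.
Qed.

(** Take determinants in [V ('X - A) = ('X - B) V] and cancel [\det V]; no inverse of [V] is
    needed. *)
Lemma char_poly_conj (F : fieldType) n (V A B : 'M[F]_n) :
  \det V != 0 -> V *m A = B *m V -> char_poly A = char_poly B.
Proof.
move=> V_unit VA; apply/(@mulfI _ (\det V)%:P); first by rewrite polyC_eq0.
rewrite -det_map_mx [RHS]mulrC -!det_mulmx; congr (\det _).
by rewrite mulmxBr mulmxBl scalar_mxC -!map_mxM VA.
Qed.

Lemma det_Vandermonde_neq0 (F : idomainType) n (a : 'rV[F]_n) :
  injective (a 0) -> \det (Vandermonde n a) != 0.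
Proof.
move=> a_inj; rewrite det_Vandermonde; apply/prodf_neq0 => i _.
apply/prodf_neq0 => j lt_ij; rewrite subr_eq0 (inj_eq a_inj).
by apply: contraTneq lt_ij => ->; rewrite ltnn.
Qed.

(** * Spectrum of a circulant graph *)

Section Circulant.

(** When [w ^+ n = 1], the term [w ^+ (n - s)] is the inverse of [w ^+ s], written so as to make
    sense in any ring. *)
Definition circ_eigenvalue (F : pzRingType) n (S : seq nat) (w : F) : F :=
  \sum_(s <- S) (w ^+ s + w ^+ (n - s)).

Lemma circ_simple n S :
  all (fun s => 0 < s < n)%N S -> simple_graph (circ n S).
Proof.
move=> /allP S_bnd; split=> [i j|i].
  by apply: eq_in_has => s _; rewrite orbC; congr (_ || _); rewrite eq_sym.
apply/hasPn => s /S_bnd /andP[s_gt0 s_lt].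
rewrite -{1}[i : nat]addn0 -{4}[i : nat]addn0 !eqn_modDl mod0n modn_small //.
lia.
Qed.

Variables (n : nat) (S : seq nat).
Hypotheses (S_uniq : uniq S) (S_bnd : all (fun s => 0 < s < n - s)%N S).

(** The connection set closed under negation modulo [n]: adjacency of two vertices depends only on
    whether their difference lies in it. *)
Let residues := S ++ [seq (n - s)%N | s <- S].

Lemma circ_residues (i j d : 'I_n) :
  i = ((j + d) %% n)%N :> nat -> circ n S i j = (val d \in residues).
Proof.
rewrite /circ => ->; have d_lt := ltn_ord d; rewrite mem_cat.
apply/hasP/orP => [[s sS]|].
  have /andP[s_gt0 s_lt] := allP S_bnd s sS.
  case/orP; rewrite ?modnDml ?modn_mod.
    rewrite -{1}[j : nat]addn0 -addnA eqn_modDl mod0n eq_sym => ds0; right.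
    apply/mapP; exists s => //=.
    case: (ltnP (d + s) n) ds0 => [/modn_small -> /eqP|le_n]; first by lia.
    rewrite -{1}(subnKC le_n) modnDl modn_small; lia.
  rewrite eqn_modDl !modn_small //; last lia.
  by move=> /eqP sd; left; rewrite /= -sd.
case=> [dS|/mapP[s sS /= ->]].
  exists (val d) => //; rewrite modn_mod.
  by rewrite eqxx orbT.
have /andP[s_gt0 s_lt] := allP S_bnd s sS.
exists s => //; rewrite modnDml -addnA subnK; last lia.
by rewrite modnDr eqxx.
Qed.

(** The bound [s < n - s] keeps [S] and its negatives disjoint, so no residue is counted twice. *)
Lemma residues_sum (F : pzRingType) (w : F) :
  \sum_(d < n | val d \in residues) w ^+ d = circ_eigenvalue n S w.
Proof.
rewrite /circ_eigenvalue big_split /= -(big_map (subn n) predT (fun r => w ^+ r)).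
rewrite -big_cat -(big_mkord (fun d => d \in residues) (fun d => w ^+ d)) -big_filter.
apply: perm_big; apply: uniq_perm.
- by rewrite filter_uniq // iota_uniq.
- rewrite cat_uniq S_uniq /= map_inj_in_uniq ?S_uniq ?andbT.
    apply/hasPn => _ /mapP[s sS ->]; apply/negP => nsS.
    by have := allP S_bnd s sS; have := allP S_bnd _ nsS; lia.
  move=> r s /(allP S_bnd) rb /(allP S_bnd) sb; lia.
move=> d; rewrite mem_filter mem_index_iota /=; case: (boolP (d \in _)) => //=.
rewrite mem_cat => /orP[/(allP S_bnd)|/mapP[s /(allP S_bnd) sb ->]]; lia.
Qed.

Lemma circ_eigenvector (F : comPzRingType) (w : F) (j : 'I_n) : w ^+ n = 1 ->
  \sum_(i < n) w ^+ i * (circ n S i j)%:R = circ_eigenvalue n S w * w ^+ j.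
Proof.
move=> wn; rewrite -residues_sum mulrC mulr_sumr [RHS]big_mkcond /=.
have n_gt0 : (0 < n)%N by case: j => j; lia.
(* Translation by [j] permutes the vertices, so the sum can run over the difference [d] of [i] and
   [j]. *)
pose h (d : 'I_n) := Ordinal (ltn_pmod (j + d) n_gt0).
have h_inj : injective h.
  move=> d e /(congr1 val) /= /eqP; rewrite eqn_modDl !modn_small //.
  by move=> /eqP /val_inj.
rewrite (reindex_inj h_inj); apply: eq_bigr => d _.
rewrite (@circ_residues (h d) j d) //=.
by rewrite expr_mod // exprD; case: ifP => _; rewrite ?mulr1 ?mulr0.
Qed.

Lemma mup_char_poly_circ (R : realType) (z : algC) : n.-primitive_root z ->
  mup 0 (char_poly (adjmx R (circ n S))) =
  #|[pred k : 'I_n | circ_eigenvalue n S (z ^+ k) == 0]|.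
Proof.
(* The entries are 0 or 1, so the matrix is already defined over [rat]; this carries the
   multiplicity from [R] to [algC], where the primitive root [z] lives. *)
move=> z_prim; pose adj (F : pzRingType) : 'M[F]_n := \matrix_(i, j) (circ n S i j)%:R.
have adj_rat (F : numFieldType) : adj F = map_mx ratr (adj rat).
  by apply/matrixP => i j; rewrite !mxE ratr_nat.
have mup_rat (F : numFieldType) :
    mup 0 (char_poly (adj F)) = mup 0 (char_poly (adj rat)).
  rewrite adj_rat -map_char_poly -[0 in LHS](rmorph0 (@ratr F)) mup_map //.
  exact/monic_neq0/char_poly_monic.
rewrite /adjmx -/(adj R) mup_rat -(mup_rat algC).
pose a : 'rV[algC]_n := \row_k z ^+ k.
pose lam : 'rV[algC]_n := \row_k circ_eigenvalue n S (z ^+ k).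
(* Row [k] of the transposed Vandermonde matrix lists the powers of [z ^+ k], a left eigenvector. *)
rewrite (@char_poly_conj _ _ (Vandermonde n a)^T _ (diag_mx lam)).
- rewrite char_poly_trig ?diag_mx_is_trig //.
  rewrite -(big_map (fun i => diag_mx lam i i) predT (fun y => 'X - y%:P)).
  rewrite mu_prod_XsubC count_map cardE /enum_mem size_filter.
  by apply: eq_count => k /=; rewrite !mxE eqxx mulr1n.
- rewrite det_tr det_Vandermonde_neq0 // => i j.
  rewrite !mxE => /eqP; rewrite (eq_prim_root_expr z_prim) !modn_small //.
  by move=> /eqP /val_inj.
apply/matrixP => k j; rewrite mul_diag_mx !mxE -circ_eigenvector.
  by apply: eq_bigr => i _; rewrite !mxE.
by rewrite exprAC (prim_expr_order z_prim) expr1n.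
Qed.

End Circulant.

(** * Zero eigenvalues for consecutive generators *)

Section ConsecutiveGenerators.

Variables (n x t : nat).
Hypotheses (x_gt0 : (0 < x)%N) (t_gt0 : (0 < t)%N) (n_ge : (2 * x + 4 * t <= n)%N).

Let S := index_iota x (x + 2 * t).

Lemma circ_eigenvalue_closed (F : comPzRingType) (w : F) : w ^+ n = 1 ->
  (w - 1) * w ^+ (x + 2 * t - 1) * circ_eigenvalue n S w =
  (w ^+ (2 * t) - 1) * (w ^+ (2 * x + 2 * t - 1) + 1).
Proof.
move=> wn; have shift (f : nat -> F) : \sum_(s <- S) f s = \sum_(i < 2 * t) f (i + x)%N.
  by rewrite /S -{1}[x]add0n big_addn addKn big_mkord.
rewrite /circ_eigenvalue big_split /= !shift subrX1 -!mulrA; congr (_ * _).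
rewrite mulrDr mulrDr mulr1; congr (_ + _).
  rewrite mulr_sumr mulr_suml.
  by apply: eq_bigr => i _; rewrite -!exprD; congr (_ ^+ _); lia.
(* Reversing the order makes the exponents [n - s] increase, so that they become [n + i] after
   multiplication by the prefactor. *)
rewrite (reindex_inj rev_ord_inj) mulr_sumr.
apply: eq_bigr => i _ /=; have i_lt := ltn_ord i; rewrite -exprD.
have -> : (x + 2 * t - 1 + (n - (2 * t - i.+1 + x)) = n + i)%N by lia.
by rewrite exprD wn mul1r.
Qed.

Lemma circ_eigenvalue_eq0 (F : numFieldType) (w : F) : w ^+ n = 1 ->
  (circ_eigenvalue n S w == 0) =
  (w != 1) && ((w ^+ (2 * t) == 1) || (w ^+ (2 * x + 2 * t - 1) == -1)).
Proof.
(* At [w = 1] the closed form reads [0 = 0]; there the eigenvalue is the degree [4t], which is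
   nonzero. Elsewhere the prefactor cancels. *)
move=> wn; have [->|w_neq1] /= := eqVneq w 1.
  apply/negbTE; rewrite /circ_eigenvalue (eq_bigr (fun=> 2%:R)); last first.
    by move=> s _; rewrite !expr1n.
  by rewrite big_const_seq count_predT iter_addr_0 -mulrnA pnatr_eq0 size_iota; lia.
have w_neq0 : w != 0.
  have n_neq0 : (n == 0%N) = false by lia.
  by apply: contra_eq_neq wn => ->; rewrite expr0n n_neq0 eq_sym oner_neq0.
have := congr1 (fun y => y == 0) (circ_eigenvalue_closed wn).
rewrite !mulf_eq0 !subr_eq0 addr_eq0 (negbTE w_neq1) expf_eq0 (negbTE w_neq0).
by rewrite andbF.
Qed.

End ConsecutiveGenerators.

(** * From roots of unity to gcd conditions *)

Section GcdConditions.

Variables (n h : nat) (z : algC).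
Hypotheses (h_gt0 : (0 < h)%N) (n_eq : n = (2 * h)%N).
Hypothesis (z_prim : n.-primitive_root z).

Lemma prim_root_half : z ^+ h = -1.
Proof.
have : z ^+ h ^+ 2 == 1 by rewrite -exprM mulnC -n_eq (prim_expr_order z_prim).
rewrite sqrf_eq1 => /orP[|/eqP //].
by rewrite -(prim_order_dvd z_prim) => /dvdn_leq; lia.
Qed.

Lemma gcd_conditions (t m : nat) : odd m ->
  (forall k, z ^+ k != 1 ->
     (z ^+ k ^+ (2 * t) == 1) || (z ^+ k ^+ m == -1) -> z ^+ k = -1) <->
  gcdn h t = 1%N /\ gcdn h m = 1%N.
Proof.
move=> m_odd; have sqr_eq1 k : z ^+ k != 1 -> (z ^+ k == -1) = (n %| k * 2)%N.
  by move=> zk1; rewrite (prim_order_dvd z_prim) exprM sqrf_eq1 (negbTE zk1).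
split=> [only_m1|[ht1 hm1] k zk1 /orP[]]; last 2 first.
- rewrite -exprM -(prim_order_dvd z_prim) n_eq => n_dvd; apply/eqP; rewrite sqr_eq1 // n_eq.
  move: n_dvd; rewrite mulnCA dvdn_pmul2l // [(k * 2)%N]mulnC dvdn_pmul2l //.
  by rewrite Gauss_dvdl // /coprime ht1.
(* Squaring removes the sign: [n] divides [2km], so [h] divides [km], hence [k] by coprimality. *)
- move=> zkm; apply/eqP; rewrite sqr_eq1 // n_eq.
  rewrite [(k * 2)%N]mulnC dvdn_pmul2l // -(@Gauss_dvdl _ _ m) ?/coprime ?hm1 //.
  rewrite -(@dvdn_pmul2l 2) // -n_eq (prim_order_dvd z_prim) mulnC !exprM (eqP zkm).
  by rewrite sqrrN expr1n.
(* For a divisor [d] of [h], test the root [z ^ (h / d)], of order [2d]. *)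
have divisor_eq1 d : (d %| h)%N ->
    (z ^+ (h %/ d)%N ^+ (2 * t) == 1) || (z ^+ (h %/ d)%N ^+ m == -1) -> d = 1%N.
  move=> dvd_dh zd; have d_gt0 := dvdn_gt0 h_gt0 dvd_dh.
  have zd1 : z ^+ (h %/ d)%N != 1.
    apply/eqP => /(congr1 (fun y => y ^+ d)).
    rewrite -exprM divnK // prim_root_half expr1n => /eqP.
    by rewrite eqNr oner_eq0.
  (* If this root is [-1], its square is 1, so [h] divides [h / d] and [d] must be 1. *)
  have /eqP := only_m1 _ zd1 zd; rewrite sqr_eq1 // n_eq mulnC.
  rewrite dvdn_pmul2r // => /dvdn_leq; rewrite divn_gt0 // => /(_ (dvdn_leq h_gt0 dvd_dh)).
  rewrite leq_divRL // => hd; apply/eqP; nia.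
(* For [d = gcd(h, t)] the power [2t] of the test root is [z ^ (n t / d) = 1]. For [d = gcd(h, m)]
   its power [m] is [(z ^ h) ^ (m / d) = -1], because [m / d] is odd. *)
split; apply: divisor_eq1 (dvdn_gcdl _ _) _; set d := gcdn _ _.
  have /dvdnP[q ->] : (d %| t)%N := dvdn_gcdr _ _.
  rewrite -exprM mulnCA mulnA mulnA -[(_ * _ * q * d)%N]mulnA.
  rewrite (_ : (_ * _ = n * q)%N) ?exprM ?(prim_expr_order z_prim) ?expr1n ?eqxx //.
  by rewrite n_eq -[h in RHS](@divnK d) ?dvdn_gcdl //; lia.
have /dvdnP[q mE] : (d %| m)%N := dvdn_gcdr _ _.
have q_odd : odd q by move: m_odd; rewrite mE oddM => /andP[].
apply/orP; right; rewrite mE [(q * d)%N]mulnC exprM -[_ ^+ d]exprM divnK ?dvdn_gcdl //.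
rewrite prim_root_half.
by rewrite -signr_odd q_odd expr1 eqxx.
Qed.

End GcdConditions.

(* Characterisation of the nut graphs *)
Local Close Scope ring_scope.

Theorem theorem6 (R : realType) (n x t : nat)
    (n_gt0 : 0 < n) (x_gt0 : 0 < x) (t_gt0 : 0 < t)
    (n_even : ~~ odd n) (n_ge : 2 * x + 4 * t <= n) :
  nut_graph R (circ n (index_iota x (x + 2 * t))) <->
  gcdn (n %/ 2) t = 1 /\ gcdn (n %/ 2) (2 * x + 2 * t - 1) = 1.
Proof.
set S := index_iota _ _.
have S_uniq : uniq S := iota_uniq _ _.
have S_bnd : all (fun s => 0 < s < n - s)%N S.
  by apply/allP => s; rewrite mem_index_iota; lia.
have S_simple : simple_graph (circ n S).
  by apply: circ_simple; apply/allP => s; rewrite mem_index_iota; lia.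
have [z z_prim] := C_prim_root_exists n_gt0.
have n_half : n = (2 * (n %/ 2))%N by lia.
have half_gt0 : (0 < n %/ 2)%N by lia.
have mE := mup_char_poly_circ S_uniq S_bnd R z_prim.
have zn k : (z ^+ k ^+ n = 1)%R by rewrite exprAC (prim_expr_order z_prim) expr1n.
have half_lt : (n %/ 2 < n)%N by lia.
(* The index of the root [-1], at which the eigenvalue always vanishes. *)
pose k0 := Ordinal half_lt.
have zk0 : (z ^+ k0 = -1)%R by exact: prim_root_half half_gt0 n_half z_prim.
have eig0 k : (circ_eigenvalue n S (z ^+ k) == 0)%R = _ :=
  circ_eigenvalue_eq0 x_gt0 t_gt0 n_ge (zn k).
have m_odd : odd (2 * x + 2 * t - 1) by lia.
have m1_neq1 (F : numFieldType) : (-1 != 1 :> F)%R.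
  by rewrite eqNr oner_eq0.
have k0_eig : (circ_eigenvalue n S (z ^+ k0) == 0)%R.
  by rewrite eig0 zk0 m1_neq1 exprM sqrrN !expr1n eqxx.
rewrite -(gcd_conditions half_gt0 n_half z_prim t m_odd).
split=> [[_ _ + _] k zk1 zk|only_m1].
  (* Multiplicity 1 leaves a single index with eigenvalue 0; both [k0] and [k] modulo [n] qualify,
     so they agree. *)
  rewrite mE => /eqP /card1P[k1 k1E].
  have zmod : (z ^+ (k %% n) = z ^+ k)%R by rewrite (prim_expr_mod z_prim).
  have := k1E (Ordinal (ltn_pmod k n_gt0)); have := k1E k0.
  rewrite !inE k0_eig /= zmod eig0 zk1 zk /= => /esym/eqP <- /esym/eqP /(congr1 val) /= kE.
  by rewrite -zmod kE.
split=> //; first by lia.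
  rewrite mE -(card1 k0); apply: eq_card => k; rewrite !inE.
  apply/idP/eqP => [|-> //]; rewrite eig0 => /andP[zk1 zk].
  have := eq_prim_root_expr z_prim k k0.
  rewrite zk0 (only_m1 k zk1 zk) eqxx !modn_small //.
  by move=> /esym/eqP/val_inj.
(* The eigenvector of the root [-1] is real, so it is given directly over [R]; evenness of [n] makes
   [-1] an [n]-th root of unity. *)
exists (\row_j (-1) ^+ j)%R; split.
- by apply/rV0Pn; exists k0; rewrite mxE signr_eq0.
- apply/eigenspaceP; apply/rowP => j; rewrite scale0r !mxE.
  have Rn : ((-1 : R) ^+ n = 1)%R by rewrite -signr_odd (negbTE n_even).
  rewrite (eq_bigr (fun i : 'I_n => (-1) ^+ i * (circ n S i j)%:R)%R); last first.
    by move=> i _; rewrite !mxE.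
  rewrite (circ_eigenvector S_uniq S_bnd j Rn).
  have /eqP -> : (circ_eigenvalue n S (-1 : R) == 0)%R.
    by rewrite circ_eigenvalue_eq0 // m1_neq1 exprM sqrrN !expr1n eqxx.
  by rewrite mul0r.
- by move=> j; rewrite mxE signr_eq0.
Qed.
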